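(* Let $P(N_{loc})=a_dN_{loc}^d+a_{d-1}N_{loc}^{d-1}+\dots+a_0$, $a_d\neq0$, be the polynomial of degree $d=2$ denoting the time complexity of computing the local tangent linear model on a subdomain $\Delta_j\times\Omega_i$ of size $N_{loc}$. Let $l_{ji}$ and $m_{ji}$ be the numbers of steps of the outer and of the inner loop, respectively, of the local 4D-Var algorithm $\mathcal{A}^{Loc}_{4DVar}$ on $\Delta_j\times\Omega_i$. Then the time complexity of this algorithm satisfies $$T\big(\mathcal{A}^{Loc}_{4DVar}(\Delta_j\times\Omega_i)\big)=O\big(m_{ji}\,l_{ji}\,P(N_{loc})\big).$$
   Context: A space-time grid of size $M\times K$ ($M$ time points, $K$ spatial points) is uniformly decomposed into $q\times p$ subdomains $\Delta_j\times\Omega_i$, each of size $N_{loc}=D_t\times D_s$ with $D_t=M/q\ge1$, $D_s=K/p\ge1$. The local algorithm $\mathcal{A}^{Loc}_{4DVar}(\Delta_j\times\Omega_i)$ (a Gauss–Newton method for the local 4D-Var nonlinear least-squares problem) consists of an outer loop with $l_{ji}\ge1$ steps, each containing an inner loop (iterative solution of the normal equations) with $m_{ji}\ge1$ steps. Its cost is accounted as follows. Let $T_{TLM}=P(N_{loc})>0$ be the cost of computing the local tangent linear model and $T_{ADJ}$ the cost of the local adjoint model (the transpose of the tangent linear model), which is a constant multiple of $T_{TLM}$ (with constant at least $4$). Each outer step costs one computation of the tangent linear model plus the cost of its $m_{ji}$ inner steps, and each inner step costs $O(T_{TLM}+T_{ADJ})$; thus $$T\big(\mathcal{A}^{Loc}_{4DVar}(\Delta_j\times\Omega_i)\big)=l_{ji}\Big[T_{TLM}+m_{ji}\cdot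 O\big(T_{TLM}+T_{ADJ}\big)\Big].$$ The constants implied by the $O$ symbols are independent of $N_{loc}$, $l_{ji}$ and $m_{ji}$. *)

(* Defs.v *)
From mathcomp Require Import all_boot all_order all_algebra.
From mathcomp Require Import all_classical all_reals all_analysis.

Set Implicit Arguments.
Unset Strict Implicit.
Unset Printing Implicit Defensive.

Import Order.TTheory GRing.Theory Num.Theory.
Import numFieldNormedType.Exports.

Local Open Scope ring_scope.
Local Open Scope classical_set_scope.

(* [globally A] is the principal filter of [A], so
   this is Landau's O with one constant valid at every point of [A], and no
   limit is taken. *)
Definition bigO_on (R : realType) (X : Type) (A : set X) (f g : X -> R) : Prop :=
  (f : X -> R^o) =O_ (FilterType (globally A) (globally_filter A)) (g : X -> R^o).

(* An execution of the local algorithms on a uniformly decomposed space-time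
   grid, together with the costs it incurs.  [time_points] and [space_points]
   are M and K; [inner_cost k s] is the cost of step s of the inner loop
   contained in step k of the outer loop.  That q and p are positive follows
   from [Dt_ge1] and [Ds_ge1], as x %/ 0 = 0. *)
Record execution (R : realType) := Execution {
  time_points : nat;
  space_points : nat;
  q : nat;
  p : nat;
  q_dvd : (q %| time_points)%N;
  p_dvd : (p %| space_points)%N;
  Dt_ge1 : (1 <= time_points %/ q)%N;
  Ds_ge1 : (1 <= space_points %/ p)%N;
  outer_steps : 'I_q -> 'I_p -> nat;
  inner_steps : 'I_q -> 'I_p -> nat;
  outer_steps_ge1 : forall j i, (1 <= outer_steps j i)%N;
  inner_steps_ge1 : forall j i, (1 <= inner_steps j i)%N;
  tlm_cost : 'I_q -> 'I_p -> R;
  adj_cost : 'I_q -> 'I_p -> R;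
  inner_cost : forall j i, 'I_(outer_steps j i) -> 'I_(inner_steps j i) -> R
}.

(* The subdomain Delta_j x Omega_i of an execution is encoded by (j, i). *)
Definition subdomain (R : realType) : Type :=
  {e : execution R & ('I_(q e) * 'I_(p e))%type}.

Section SubdomainData.
Variable R : realType.
Implicit Type x : subdomain R.

Definition Dt x : nat := (time_points (tag x) %/ q (tag x))%N.
Definition Ds x : nat := (space_points (tag x) %/ p (tag x))%N.
Definition Nloc x : nat := (Dt x * Ds x)%N.

Definition nb_outer x : nat := outer_steps (tagged x).1 (tagged x).2.
Definition nb_inner x : nat := inner_steps (tagged x).1 (tagged x).2.

Definition T_TLM x : R := tlm_cost (tagged x).1 (tagged x).2.
Definition T_ADJ x : R := adj_cost (tagged x).1 (tagged x).2.
Definition T_inner x (k : 'I_(nb_outer x)) (s : 'I_(nb_inner x)) : R :=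
  inner_cost k s.

Definition T_outer x (k : 'I_(nb_outer x)) : R :=
  T_TLM x + \sum_(s < nb_inner x) T_inner k s.

Definition T_Loc x : R := \sum_(k < nb_outer x) T_outer k.

End SubdomainData.

Definition inner_step (R : realType) : Type :=
  {x : subdomain R & ('I_(nb_outer x) * 'I_(nb_inner x))%type}.

Definition T_inner_step (R : realType) (y : inner_step R) : R :=
  T_inner (tagged y).1 (tagged y).2.

(* Main.v *)
Require Import Defs.
From mathcomp Require Import all_boot all_order all_algebra.
From mathcomp Require Import all_classical all_reals all_analysis.

Import Order.TTheory GRing.Theory Num.Theory.
Import numFieldNormedType.Exports.

Local Open Scope ring_scope.
Local Open Scope classical_set_scope.

(** One constant [C] bounds every inner step by [C * (T_TLM + T_ADJ) = b * T_TLM] with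
    [b = C * (1 + c)]. An outer step with m inner steps thus costs at most [T_TLM + m * b * T_TLM],
    and m >= 1 absorbs the lone [T_TLM], leaving [(1 + b) * m * T_TLM]. Summing over the outer steps
    ([T_Loc_le]) and using [T_TLM = P(N_loc)] gives the bound. *)

(** Along a principal filter, an eventual bound is a bound at every point of [A]. *)
Lemma bigO_onP (R : realType) (X : Type) (A : set X) (f g : X -> R) :
  bigO_on A f g <->
  exists2 C : R, 0 < C & forall x, A x -> `|f x| <= C * `|g x|.
Proof.
rewrite /bigO_on; split => [/eqO_exP [C C0 fg]|[C C0 fg]].
  by exists C.
by apply/eqO_exP; exists C.
Qed.

Lemma T_Loc_le (R : realType) (x : subdomain R) (b : R) (b_ge0 : 0 <= b)
    (hT : 0 <= T_TLM x) (m_gt0 : (0 < nb_inner x)%N)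
    (hb : forall (k : 'I_(nb_outer x)) (s : 'I_(nb_inner x)),
      `|T_inner k s| <= b * T_TLM x) :
  `|T_Loc x| <= (1 + b) * ((nb_inner x)%:R * (nb_outer x)%:R * T_TLM x).
Proof.
have m_ge1 : 1 <= (nb_inner x)%:R :> R by rewrite ler1n.
have outer_le (k : 'I_(nb_outer x)) :
    `|T_outer k| <= (1 + b) * ((nb_inner x)%:R * T_TLM x).
  rewrite mulrDl mul1r; apply: le_trans (ler_normD _ _) _; apply: lerD.
    (* Here m >= 1 enters: [T_TLM] is at most m times itself. *)
    by rewrite ger0_norm// ler_peMl.
  apply: le_trans (ler_norm_sum _ _ _) _.
  apply: le_trans (ler_sum _ (fun s _ => hb k s)) _.
  by rewrite sumr_const card_ord -[leLHS]mulr_natl mulrCA.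
apply: le_trans (ler_norm_sum _ _ _) _.
apply: le_trans (ler_sum _ (fun k _ => outer_le k)) _.
by rewrite sumr_const card_ord -[leLHS]mulr_natl mulrCA mulrA
  [_%:R * _%:R]mulrC -!mulrA mulrCA.
Qed.

Theorem proposition2 (R : realType) (P : {poly R}) (c : R)
    (E : set (execution R))
    (hP : size P = 3%N)
    (hc : 4%:R <= c)
    (hTLM : forall x : subdomain R, E (tag x) -> T_TLM x = P.[(Nloc x)%:R])
    (hTLM_gt0 : forall x : subdomain R, E (tag x) -> 0 < T_TLM x)
    (hADJ : forall x : subdomain R, E (tag x) -> T_ADJ x = c * T_TLM x)
    (hinner : bigO_on [set y : inner_step R | E (tag (tag y))]
                (fun y => T_inner_step y)
                (fun y => T_TLM (tag y) + T_ADJ (tag y))) :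
  bigO_on [set x : subdomain R | E (tag x)]
    (fun x => T_Loc x)
    (fun x => (nb_inner x)%:R * (nb_outer x)%:R * P.[(Nloc x)%:R]).
Proof.
have [C C0 innerC] := (bigO_onP _ _ _ _ _).1 hinner.
have c0 : 0 <= 1 + c by rewrite addr_ge0// (le_trans _ hc).
(* This is [1 + b], fixed before the subdomain [x] is chosen, hence uniform. *)
apply/bigO_onP; exists (1 + C * (1 + c)) => [|x Ex].
  by rewrite ltr_pwDl// mulr_ge0// ltW.
have T0 := hTLM_gt0 x Ex.
rewrite -hTLM// [X in _ <= _ * X]ger0_norm; last by rewrite !mulr_ge0// ltW.
apply: T_Loc_le; [by rewrite mulr_ge0// ltW | exact: ltW | exact: inner_steps_ge1 |].
(* The uniform bound is taken at step [(k, s)] of [x]; then [T_TLM + T_ADJ] collapses to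
   [(1 + c) * T_TLM]. *)
move=> k s; have := innerC (existT _ x (k, s)) Ex.
rewrite /T_inner_step /= hADJ// -[X in X + _]mul1r -mulrDl.
by rewrite [`|_ * T_TLM x|]ger0_norm ?mulr_ge0 ?(ltW T0)// mulrA.
Qed.
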